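(* Let $p\in\mathbb N$ and $\alpha_1,\dots,\alpha_p>-1$ with $\alpha_i-\alpha_j\notin\mathbb Z$ for $i\ne j$ in $\{1,\dots,p\}$; extend the notation by $\alpha_{rp+s}:=\alpha_s+r$ for $r\in\mathbb N_0$, $s\in\{1,\dots,p\}$. Let $B_n$ and $A^{(i)}_n$ ($i=1,\dots,p$) be the step line multiple Laguerre polynomials of the first kind of type II (monic) and type I defined in the context. Then $$xB_n(x)=B_{n+1}(x)+b^0_nB_n(x)+\sum_{j=1}^pb^j_nB_{n-j}(x)\quad(n\ge0),$$ $$xA^{(i)}_n(x)=A^{(i)}_{n-1}(x)+b^0_{n-1}A^{(i)}_n(x)+\sum_{j=1}^pb^j_{n+j-1}A^{(i)}_{n+j}(x)\quad(n\ge1,\ i\in\{1,\dots,p\}),$$ with the convention $B_r=0$ for $r<0$, where for $j\in\{0,1,\dots,p\}$, $m\ge0$ and $k\in\{0,\dots,p-1\}$, $$b^j_{pm+k}=\sum_{i=k+1}^{p+k+1-j}\frac{(\alpha_i+m)\prod_{q=1}^p(\alpha_i-\alpha_q+m)}{\prod_{q=k+1,\,q\ne i}^{p+k+1-j}(\alpha_i-\alpha_q)} .$$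
   Context: $\mathbb N_0=\{0,1,2,\dots\}$; $|\vec n|=n_1+\cdots+n_p$; $(x)_0=1$, $(x)_n=x(x+1)\cdots(x+n-1)$; empty products equal $1$ and empty sums equal $0$. The multiple Laguerre polynomials of the first kind are the multiple orthogonal polynomials for the weights $e^{-x}x^{\alpha_i}$, $i=1,\dots,p$, with respect to $dx$ on $[0,\infty)$. For $\vec n=(n_1,\dots,n_p)\in\mathbb N_0^p$: Type II (monic, degree $|\vec n|$): with $\lambda_r=l_r+\cdots+l_p$ ($1\le r\le p$), $\lambda_{p+1}=0$, $$L_{\vec n}(x)=\sum_{l_1=0}^{n_1}\cdots\sum_{l_p=0}^{n_p}(-1)^{|\vec n|}\prod_{q=1}^p\left[(\alpha_q+1)_{n_q}\frac{(-n_q)_{l_q}}{l_q!}\right]\prod_{r=1}^p\frac{(\alpha_r+n_r+1)_{\lambda_{r+1}}}{(\alpha_r+1)_{\lambda_r}}\;x^{l_1+\cdots+l_p}.$$ Type I: $L^{(i)}_{\vec n}=0$ if $n_i=0$, and if $n_i\ge1$ (all products over $q\in\{1,\dots,p\}$), $$L^{(i)}_{\vec n}(x)=\frac{(-1)^{|\vec n|-1}}{(n_i-1)!\,\Gamma(\alpha_i+1)\prod_{q\ne i}(\alpha_q-\alpha_i)_{n_q}}\sum_{l=0}^{n_i-1}\frac{(-n_i+1)_l}{l!\,(\alpha_i+1)_l}\prod_{q\ne i}\frac{(\alpha_i-\alpha_q-n_q+1)_l}{(\alpha_i-\alpha_q+1)_l}\,x^l .$$ Step line: for $m\ge0$, $k\in\{0,\dots,p-1\}$,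 let $\vec n(pm+k)$ be the multi-index whose first $k$ entries are $m+1$ and whose remaining $p-k$ entries are $m$; put $B_n=L_{\vec n(n)}$ and $A^{(i)}_n=L^{(i)}_{\vec n(n)}$ (in particular $A^{(i)}_0=0$). *)

(* Defs.v *)
From HB Require Import structures.
From mathcomp Require Import all_boot all_order all_algebra.
From mathcomp Require Import all_classical all_reals all_analysis.

Set Implicit Arguments.
Unset Strict Implicit.
Unset Printing Implicit Defensive.

Import Order.TTheory GRing.Theory Num.Theory.
Import numFieldNormedType.Exports.
Local Open Scope ring_scope.

(* All indices are 0-based: 'I_p stands for {1, ..., p}, and alpha i is the    *)
(* parameter usually written alpha_(i+1).                                      *)

(* (x)_n = x (x + 1) ... (x + n - 1) *)
Definition poch (R : realType) (x : R) (n : nat) : R :=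
  \prod_(0 <= j < n) (x + j%:R).

(* Meaningful for z > 0, where the integral converges. *)
Definition Gamma (R : realType) (z : R) : R :=
  \int[@lebesgue_measure R]_(x in `]0, +oo[%classic) (x `^ (z - 1) * expR (- x)).

Definition msize (p : nat) (n : 'I_p -> nat) : nat := (\sum_(i < p) n i)%N.

(* The multi-sum over 0 <= l_q <= n_q is a sum over the l : 'I_p ->            *)
(* {0, ..., |n|} that satisfy l_q <= n_q.  For the 0-based r, the sum of the   *)
(* l q with r < q is lambda_(r+1) and that of the l q with r <= q is lambda_r. *)
Definition laguerreII (R : realType) (p : nat) (alpha : 'I_p -> R)
    (n : 'I_p -> nat) : {poly R} :=
  \sum_(l : {ffun 'I_p -> 'I_(msize n).+1} | [forall q, (l q <= n q)%N])
    ((-1) ^+ msize n *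
     \prod_(q < p) (poch (alpha q + 1) (n q) *
                    (poch (- (n q)%:R) (l q) / (l q)`!%:R)) *
     \prod_(r < p) (poch (alpha r + (n r)%:R + 1) (\sum_(q < p | (r < q)%N) l q)%N /
                    poch (alpha r + 1) (\sum_(q < p | (r <= q)%N) l q)%N))
    *: 'X^(\sum_(q < p) l q)%N.

Definition laguerreI (R : realType) (p : nat) (alpha : 'I_p -> R)
    (n : 'I_p -> nat) (i : 'I_p) : {poly R} :=
  if n i == 0%N then 0 else
  ((-1) ^+ (msize n - 1) /
   ((n i - 1)`!%:R * Gamma (alpha i + 1) *
    \prod_(q < p | q != i) poch (alpha q - alpha i) (n q)))
  *: \sum_(0 <= l < n i)
       (poch (- (n i)%:R + 1) l / (l`!%:R * poch (alpha i + 1) l) *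
        \prod_(q < p | q != i) (poch (alpha i - alpha q - (n q)%:R + 1) l /
                                poch (alpha i - alpha q + 1) l)) *: 'X^l.

(* With n = p m + k, 0 <= k < p: the first k entries are m + 1, the others m. *)
Definition stepline (p n : nat) : 'I_p -> nat :=
  fun i => if (i < n %% p)%N then (n %/ p).+1 else (n %/ p)%N.

Definition stepB (R : realType) (p : nat) (alpha : 'I_p -> R) (n : nat) : {poly R} :=
  laguerreII alpha (@stepline p n).

Definition stepA (R : realType) (p : nat) (alpha : 'I_p -> R) (i : 'I_p) (n : nat) :
    {poly R} :=
  laguerreI alpha (@stepline p n) i.

(* alpha_(r p + s) = alpha_s + r *)
Definition alpha_ext (R : realType) (p : nat) (hp : (0 < p)%N) (alpha : 'I_p -> R)
    (t : nat) : R :=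
  alpha (Ordinal (ltn_pmod t hp)) + (t %/ p)%:R.

(* b^j_(p m + k), for j <= p and k < p; the 1-based range k + 1 <= i <=        *)
(* p + k + 1 - j becomes k <= i <= p + k - j.                                  *)
Definition recb_mk (R : realType) (p : nat) (hp : (0 < p)%N) (alpha : 'I_p -> R)
    (j m k : nat) : R :=
  let a := alpha_ext hp alpha in
  \sum_(k <= i < (p + k - j).+1)
    ((a i + m%:R) * \prod_(q < p) (a i - alpha q + m%:R) /
     \prod_(k <= q < (p + k - j).+1 | q != i) (a i - a q)).

Definition recb (R : realType) (p : nat) (hp : (0 < p)%N) (alpha : 'I_p -> R)
    (j n : nat) : R :=
  recb_mk hp alpha j (n %/ p) (n %% p).

(* Main.v *)
Require Import Defs.
From mathcomp Require Import all_boot all_order all_algebra ring zify.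
From mathcomp Require Import all_classical all_reals all_analysis.
Import Order.TTheory GRing.Theory Num.Theory.
Set Implicit Arguments.
Unset Strict Implicit.
Unset Printing Implicit Defensive.
Local Open Scope ring_scope.

(** The coefficients of both recurrences are divided differences of one
    polynomial, and both recurrences are Newton interpolation of that
    polynomial; the two polynomial families only enter through a dictionary.

    Let a_t be the extended parameters, so that a_(t+p) = a_t + 1, and write
    w(u,v) for the product of the X - a_t with u <= t < v.  With
    f = X * w(0,p) and n = p m + k, shifting all the nodes by m shows that
    b^j_n is the divided difference of f at a_n, ..., a_(n+p-j) ([recbE]).
    As f is monic of degree p + 1, Newton interpolation at a_n, ..., a_(n+p),
    taken in increasing or in decreasing order, yields ([newton_forward],
    [newton_backward])
      f = w(n,n+p+1) + sum_(0 <= j <= p) b^j_n     w(n,n+p-j)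
      f = w(n,n+p+1) + sum_(0 <= j <= p) b^j_(n+j) w(n+j+1,n+p+1).

    Type II.  Integrating x^(s+l) e^(-x) gives Gamma(s+1) (s+1)_l, so the
    normalised Mellin transform at s, weighted by e^(-x), is the linear form
    that sends X^l to (s+1)_l.  It turns B_n into w(0,n)(s)
    ([mellin_stepB]): the nested sum collapses by one Chu-Vandermonde
    summation per index.  It turns multiplication by X into s -> s + 1
    followed by multiplication by s + 1, and shifting s by one moves the nodes
    of w(0,n) to those of w(p,n+p).  So the recurrence for B_n is the expansion
      X w(0,n) = w(p,n+p+1) + sum_j b^j_n w(p,n+p-j),
    which is the first Newton formula multiplied by w(0,n) / w(0,p); the
    terms with j > n vanish because then all the nodes are zeros of f.

    Type I.  With t = p l + i, the coefficient of X^l in A^(i)_n is, up to a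
    factor that does not involve n, the residue of 1 / w(0,n) at a_t
    ([coef_stepA]).  Multiplication by X shifts t by p and brings out the
    factor a_t.  So the recurrence for A^(i)_n compares the residues at a_t in
    the second Newton formula divided by w(0,n+p+1) ([residue_recurrence]). *)

(** * Divided differences and Newton interpolation *)

Section DividedDifferences.
Variable F : fieldType.
Implicit Types (f g : {poly F}) (s t : seq F) (x y z : F).

(** The symmetric form of f[x_0, ..., x_k], which makes sense for pairwise
    distinct nodes. *)
Definition divdiff f s : F :=
  \sum_(x <- s) f.[x] / \prod_(y <- s | y != x) (x - y).

Definition nodepoly s : {poly F} := \prod_(y <- s) ('X - y%:P).

Lemma divdiff_perm f s t : perm_eq s t -> divdiff f s = divdiff f t.
Proof.
move=> st; rewrite /divdiff (perm_big _ st) /=.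
by apply: eq_bigr => x _; rewrite (perm_big _ st).
Qed.

Lemma eq_divdiff f g s : {in s, forall x, f.[x] = g.[x]} -> divdiff f s = divdiff g s.
Proof. by move=> fg; apply: eq_big_seq => x xs; rewrite fg. Qed.

Lemma divdiff_seq1 f x : divdiff f [:: x] = f.[x].
Proof. by rewrite /divdiff big_seq1 big_cons big_nil eqxx invr1 mulr1. Qed.

Lemma divdiff_cons f x s : x \notin s ->
  divdiff f (x :: s) = f.[x] / \prod_(y <- s) (x - y)
    + \sum_(z <- s) f.[z] / ((z - x) * \prod_(y <- s | y != z) (z - y)).
Proof.
move=> xs; rewrite /divdiff big_cons; congr (_ / _ + _).
  rewrite big_cons eqxx /= big_seq_cond [RHS]big_seq_cond; apply: eq_bigl => y.
  by case: (boolP (y \in s)) => //= ys; apply: contraNneq xs => <-.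
apply: eq_big_seq => z zs; rewrite big_cons ifT //.
by apply: contraNneq xs => ->.
Qed.

(** The classical recursion; it holds term by term because
    (x - z) / ((t - x) (t - z)) = 1 / (t - x) - 1 / (t - z). *)
Lemma divdiff_cons2 f x z s : uniq (x :: z :: s) ->
  (x - z) * divdiff f (x :: z :: s) = divdiff f (x :: s) - divdiff f (z :: s).
Proof.
move=> /= /andP[]; rewrite in_cons negb_or => /andP[xz xs] /andP[zs us].
rewrite (divdiff_cons _ xs) (divdiff_cons _ zs) divdiff_cons; last first.
  by rewrite in_cons negb_or xz.
have xz0 : x - z != 0 by rewrite subr_eq0.
have zx0 : z - x != 0 by rewrite subr_eq0 eq_sym.
have nx0 : \prod_(y <- s) (x - y) != 0.
  by rewrite prodf_seq_neq0; apply/allP => y ys /=; rewrite subr_eq0; apply: contraNneq xs => ->.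
have nz0 : \prod_(y <- s) (z - y) != 0.
  by rewrite prodf_seq_neq0; apply/allP => y ys /=; rewrite subr_eq0; apply: contraNneq zs => ->.
rewrite !big_cons eqxx /=.
have -> : \prod_(y <- s | y != z) (z - y) = \prod_(y <- s) (z - y).
  rewrite big_seq_cond [RHS]big_seq_cond; apply: eq_bigl => y.
  by case: (boolP (y \in s)) => //= ys; apply: contraNneq zs => <-.
have -> : \sum_(j <- s) f.[j] / ((j - x) * \prod_(y <- z :: s | y != j) (j - y)) =
  (x - z)^-1 * (\sum_(j <- s) f.[j] / ((j - x) * \prod_(y <- s | y != j) (j - y))
   - \sum_(j <- s) f.[j] / ((j - z) * \prod_(y <- s | y != j) (j - y))).
  rewrite -sumrB mulr_sumr; apply: eq_big_seq => j js.
  have jz : j != z by apply: contraNneq zs => <-.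
  have jx : j != x by apply: contraNneq xs => <-.
  rewrite big_cons eq_sym jz.
  have : \prod_(y <- s | y != j) (j - y) != 0.
    by rewrite prodf_seq_neq0; apply/allP => y ys; apply/implyP; rewrite subr_eq0 eq_sym.
  have jz0 : j - z != 0 by rewrite subr_eq0.
  have jx0 : j - x != 0 by rewrite subr_eq0.
  by move: (\prod_(y <- s | _) _) => P P0; field; rewrite P0 jz0 jx0 xz0.
move: (\prod_(y <- s) _) (\prod_(y <- s) _) (\sum_(j <- s) _) (\sum_(j <- s) _) nx0 nz0.
move=> A B C D A0 B0.
by field; rewrite zx0 xz0 A0 B0.
Qed.

Lemma divdiff_const c s : uniq s -> (1 < size s)%N -> divdiff c%:P s = 0.
Proof.
case: s => [//|x [//|z s]] us _.
elim: s x z us => [|y s IH] x z us.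
  have xz : x - z != 0 by case/andP: us; rewrite subr_eq0 inE.
  by apply: (mulfI xz); rewrite divdiff_cons2 // !divdiff_seq1 !hornerC subrr mulr0.
have xz : x - z != 0.
  by case/andP: us; rewrite subr_eq0 inE negb_or => /andP[].
apply: (mulfI xz); rewrite divdiff_cons2 // !IH ?subrr ?mulr0 //.
  by case/andP: us.
by move: us => /= /andP[]; rewrite in_cons negb_or => /andP[_ ->] /andP[_].
Qed.

(** Dividing f by X - x, with remainder f(x), lowers by one both the degree of
    f and the number of nodes.  This drives the induction for Newton's
    formula. *)
Lemma divdiff_peel g c x s : uniq (x :: s) -> s != [::] ->
  divdiff (g * ('X - x%:P) + c%:P) (x :: s) = divdiff g s.
Proof.
move=> us s0.
have -> : divdiff (g * ('X - x%:P) + c%:P) (x :: s) =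
  divdiff (g * ('X - x%:P)) (x :: s) + divdiff c%:P (x :: s).
  by rewrite /divdiff -big_split /=; apply: eq_bigr => y _; rewrite hornerD mulrDl.
rewrite divdiff_const ?addr0 //; last by case: s s0 {us}.
case/andP: us => xs us; rewrite divdiff_cons // hornerM hornerXsubC subrr mulr0 mul0r add0r.
apply: eq_big_seq => z zs; rewrite hornerM hornerXsubC -mulf_div.
have zx : z - x != 0 by rewrite subr_eq0; apply: contraNneq xs => <-.
by rewrite mulrA divfK.
Qed.

Lemma newton_interpolation f s : uniq s -> (size f <= size s)%N ->
  f = \sum_(i < size s) divdiff f (take i.+1 s) *: nodepoly (take i s).
Proof.
elim: s f => [|x s IH] f us szf.
  by rewrite big_ord0; apply/eqP; rewrite -size_poly_leq0.
have [g fE] : exists g, f = g * ('X - x%:P) + f.[x]%:P.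
  have /factor_theorem [g gE] : root (f - f.[x]%:P) x.
    by rewrite rootE hornerD hornerN hornerC subrr.
  by exists g; rewrite -gE subrK.
have szg : (size g <= size s)%N.
  have [->|g0] := eqVneq g 0; first by rewrite size_poly0.
  have : (size (f - f.[x]%:P)%R <= (size s).+1)%N.
    apply: leq_trans (size_polyD _ _) _; rewrite geq_max szf size_polyN.
    by apply: leq_trans (size_polyC_leq1 _) _.
  by rewrite {1}fE addrK size_Mmonic ?monicXsubC // size_XsubC addn2.
rewrite big_ord_recl /= take0 divdiff_seq1 /nodepoly big_nil.
rewrite {1}fE addrC; congr (_ + _); first by rewrite alg_polyC.
rewrite {1}(IH g) //; last by case/andP: us.
rewrite mulr_suml; apply: eq_bigr => i _.
rewrite /bump /= add1n /= -scalerAl big_cons [_ * ('X - _)]mulrC; congr (_ *: _).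
rewrite {1}fE divdiff_peel //.
  by rewrite -[x :: _]/(take i.+2 (x :: s)) take_uniq.
by move: (i); case: (s) => [[]|].
Qed.

Lemma size_nodepoly s : size (nodepoly s) = (size s).+1.
Proof. exact: size_prod_XsubC. Qed.

Lemma horner_nodepoly s x : (nodepoly s).[x] = \prod_(y <- s) (x - y).
Proof. by rewrite horner_prod; apply: eq_bigr => y _; rewrite hornerXsubC. Qed.

(** One degree more than [newton_interpolation] allows: the node polynomial
    takes away the leading term and vanishes at the nodes, so subtracting it
    changes no divided difference. *)
Lemma newton_monic f s : uniq s -> f \is monic -> size f = (size s).+1 ->
  f = nodepoly s + \sum_(i < size s) divdiff f (take i.+1 s) *: nodepoly (take i s).
Proof.
move=> us fm szf; rewrite -[LHS](subrK (nodepoly s)) addrC; congr (_ + _).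
rewrite {1}(@newton_interpolation (f - nodepoly s) s) //.
  apply: eq_bigr => i _; congr (_ *: _); apply: eq_divdiff => x /mem_take xs.
  have /rootP ws : root (nodepoly s) x by rewrite root_prod_XsubC.
  by rewrite hornerD hornerN ws oppr0 addr0.
apply/leq_sizeP => j; rewrite leq_eqVlt => /predU1P[<-|lt]; rewrite coefB.
  have wm : nodepoly s \is monic by exact: monic_prod_XsubC.
  move/monicP: fm; move/monicP: wm.
  by rewrite /lead_coef size_nodepoly szf /= => -> ->; rewrite subrr.
by rewrite !nth_default ?subrr ?size_nodepoly ?szf.
Qed.

End DividedDifferences.

(** * Rising factorials and the Chu-Vandermonde identity *)

Lemma prod_nat_neq (R : comNzRingType) m n t (F : nat -> R) : ~~ (m <= t < n)%N ->
  \prod_(m <= u < n | u != t) F u = \prod_(m <= u < n) F u.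
Proof.
move=> mt; rewrite big_nat_cond [RHS]big_nat; apply: eq_bigl => u.
by apply: andb_idr => mun; apply: contraNneq mt => <-.
Qed.

Section Pochhammer.
Variable R : realType.
Implicit Types (x b c : R) (m n l : nat).

Lemma poch0 x : poch x 0 = 1.
Proof. by rewrite /poch big_geq. Qed.

Lemma pochSr x n : poch x n.+1 = poch x n * (x + n%:R).
Proof. by rewrite /poch big_nat_recr. Qed.

Lemma pochD x m n : poch x (m + n) = poch x m * poch (x + m%:R) n.
Proof.
elim: n => [|n IH]; first by rewrite addn0 poch0 mulr1.
by rewrite addnS !pochSr IH natrD -!addrA mulrA.
Qed.

Lemma pochSl x n : poch x n.+1 = x * poch (x + 1) n.
Proof. by rewrite -add1n pochD pochSr poch0 mul1r addr0. Qed.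

Lemma poch_neq0 x n : (forall j, x + j%:R != 0) -> poch x n != 0.
Proof. by move=> h; rewrite /poch prodf_seq_neq0; apply/allP => j _; rewrite h. Qed.

Lemma poch_desc x n : \prod_(0 <= j < n) (x - j%:R) = (-1) ^+ n * poch (- x) n.
Proof.
rewrite /poch -[n in (-1) ^+ n]subn0 -prodr_const_nat -big_split /=.
by apply: eq_bigr => j _; ring.
Qed.

Lemma poch_factorial n : poch 1 n = n`!%:R :> R.
Proof. by elim: n => [|n IH]; rewrite ?poch0 // pochSr IH factS natrM mulrC addrC natr1. Qed.

Lemma poch_opp n l : poch (- n%:R) l = (-1) ^+ l * (n ^_ l)%:R :> R.
Proof.
elim: l => [|l IH]; first by rewrite poch0 mulr1.
rewrite pochSr IH ffactnSr natrM exprS.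
have [nl|ln] := ltnP n l; first by rewrite ffact_small // !(mulr0, mul0r).
rewrite natrB //; ring.
Qed.

(** Pascal's rule in summed form: the step from n to n + 1 replaces the terms
    F l by F l + F (l + 1). *)
Lemma sum_binS n (F : nat -> R) :
  \sum_(0 <= l < n.+2) 'C(n.+1, l)%:R * F l
  = \sum_(0 <= l < n.+1) 'C(n, l)%:R * (F l + F l.+1).
Proof.
rewrite big_nat_recl // bin0.
under eq_bigr => l _ do rewrite binS natrD mulrDl.
under [RHS]eq_bigr => l _ do rewrite mulrDr.
rewrite !big_split /= addrA; congr (_ + _).
rewrite [RHS]big_nat_recl // bin0 [in LHS]big_nat_recr //=.
by rewrite bin_small // mul0r addr0.
Qed.

(** Free of denominators, the identity holds for all b and c.  By Pascal's rule
    the sum for n + 1 at c is c - b times the sum for n at c + 1, since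
    the two terms paired by [sum_binS] agree up to the factors c + l and
    - (b + l). *)
Lemma chu_vandermonde_poly n b c :
  \sum_(0 <= l < n.+1) 'C(n, l)%:R * ((-1) ^+ l * poch b l * poch (c + l%:R) (n - l))
  = poch (c - b) n.
Proof.
elim: n c => [|n IH] c; first by rewrite big_nat1 !poch0 bin0; ring.
rewrite sum_binS pochSl addrAC -IH mulr_sumr.
apply: eq_big_nat => l /andP[_ ln].
rewrite subSn // pochSl pochSr exprS subSS -[l.+1%:R]natr1.
have -> : c + (l%:R + 1) = c + 1 + l%:R by ring.
have -> : c + l%:R + 1 = c + 1 + l%:R by ring.
ring.
Qed.

(** The value of the hypergeometric series 2F1(-n, b; c; 1). *)
Lemma chu_vandermonde n b c : (forall j, c + j%:R != 0) ->
  \sum_(0 <= l < n.+1) poch (- n%:R) l / l`!%:R * (poch b l / poch c l)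
  = poch (c - b) n / poch c n.
Proof.
move=> c0; rewrite -chu_vandermonde_poly mulr_suml; apply: eq_big_nat => l /andP[_ ln].
have cl0 : poch c l != 0 by exact: poch_neq0.
have cn0 : poch (c + l%:R) (n - l) != 0.
  by apply: poch_neq0 => j; rewrite -addrA -natrD.
have -> : poch c n = poch c l * poch (c + l%:R) (n - l) by rewrite -pochD subnKC.
have lf : l`!%:R != 0 :> R by rewrite pnatr_eq0 -lt0n fact_gt0.
rewrite poch_opp -bin_ffact natrM.
by field; rewrite cn0 cl0 lf.
Qed.
End Pochhammer.

(** * The Mellin transform of type II polynomials *)

Section FfunCons.
Variables (p : nat) (T : finType).

Definition ffun_cons (x : T) (g : {ffun 'I_p -> T}) : {ffun 'I_p.+1 -> T} :=
  [ffun i => if unlift ord0 i is Some j then g j else x].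

Lemma ffun_cons0 x g : ffun_cons x g ord0 = x.
Proof. by rewrite ffunE unlift_none. Qed.

Lemma ffun_consS x g j : ffun_cons x g (lift ord0 j) = g j.
Proof. by rewrite ffunE liftK. Qed.

Lemma big_ffun_cons (V : nmodType) (P : pred {ffun 'I_p.+1 -> T}) (F : {ffun 'I_p.+1 -> T} -> V) :
  \sum_(l | P l) F l = \sum_g \sum_(x | P (ffun_cons x g)) F (ffun_cons x g).
Proof.
rewrite pair_big_dep /= (reindex (fun u => ffun_cons u.2 u.1)) //=.
exists (fun l : {ffun 'I_p.+1 -> T} => ([ffun j => l (lift ord0 j)], l ord0)).
  move=> [g x] _ /=; rewrite ffun_cons0; congr (_, _).
  by apply/ffunP => j; rewrite ffunE ffun_consS.
move=> l _ /=; apply/ffunP => i; rewrite ffunE.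
by case: unliftP => [j|] ->; rewrite ?ffunE.
Qed.
End FfunCons.

Section TypeII.
Variable R : realType.

(** The first index l_0 enters only through its own factors and through the
    total l_0 + L, where L is the sum of the others.  Summing over l_0 by
    Chu-Vandermonde with b = s + 1 + L and c = alpha_0 + 1 + L removes every
    trace of index 0 except the factor (alpha_0 - s)_(n_0), and leaves
    (s + 1)_L, hence the same sum with one index less.  The bound N is kept
    apart from n because the index type of the sum must not change in the
    induction. *)
Lemma laguerreII_sum p (alpha : 'I_p -> R) (n : 'I_p -> nat) N s :
    (forall q, (n q <= N)%N) -> (forall q j, alpha q + 1 + j%:R != 0) ->
  \sum_(l : {ffun 'I_p -> 'I_N.+1} | [forall q, (l q <= n q)%N])
    (\prod_(q < p) (poch (alpha q + 1) (n q) *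
                    (poch (- (n q)%:R) (l q) / (l q)`!%:R)) *
     \prod_(r < p) (poch (alpha r + (n r)%:R + 1) (\sum_(q < p | (r < q)%N) l q)%N /
                    poch (alpha r + 1) (\sum_(q < p | (r <= q)%N) l q)%N))
    * poch (s + 1) (\sum_(q < p) l q)%N
  = \prod_(q < p) poch (alpha q - s) (n q).
Proof.
elim: p alpha n => [|p IH] alpha n nN a0.
  rewrite big_ord0; rewrite (big_pred1 [ffun i => ord0]).
    by rewrite !big_ord0 poch0 !mul1r.
  move=> f /=; rewrite (_ : f = [ffun i => ord0]) ?eqxx.
    by apply/forallP => -[].
  by apply/ffunP => -[].
rewrite big_ord_recl -(IH (fun q => alpha (lift ord0 q)) (fun q => n (lift ord0 q))) //.
rewrite big_ffun_cons mulr_sumr [RHS]big_mkcond; apply: eq_bigr => g _.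
case: ifP => gn; last first.
  rewrite big_pred0 // => x; apply/negbTE; move/negbT: gn; apply: contra => /forallP h.
  by apply/forallP => q; have := h (lift ord0 q); rewrite ffun_consS.
set L := (\sum_(q < p) g q)%N.
set c := alpha ord0 + 1; set n0 := n ord0.
set P1 := \prod_(q < p) _; set P2 := \prod_(r < p) _.
have -> : \sum_(x | [forall q, (ffun_cons x g q <= n q)%N])
  \prod_(q < p.+1) (poch (alpha q + 1) (n q) *
    (poch (- (n q)%:R) (ffun_cons x g q) / (ffun_cons x g q)`!%:R)) *
  \prod_(r < p.+1) (poch (alpha r + (n r)%:R + 1) (\sum_(q < p.+1 | (r < q)%N) ffun_cons x g q)%N /
    poch (alpha r + 1) (\sum_(q < p.+1 | (r <= q)%N) ffun_cons x g q)%N) *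
  poch (s + 1) (\sum_(q < p.+1) ffun_cons x g q)%N =
 \sum_(x < N.+1 | (x < n0.+1)%N) P1 * P2 * (poch c n0 * (poch (- n0%:R) x / x`!%:R) *
   (poch (c + n0%:R) L / poch c (L + x)) * poch (s + 1) (L + x)).
  apply: eq_big => [x|x _].
    apply/forallP/idP => [/(_ ord0)|xn q]; first by rewrite ffun_cons0.
    case: (unliftP ord0 q) => [j|] ->; rewrite ?ffun_cons0 ?ffun_consS //.
    by move/forallP: gn.
  have sumE : (\sum_(q < p.+1) ffun_cons x g q)%N = (L + x)%N.
    rewrite big_ord_recl ffun_cons0 addnC; congr (_ + _)%N.
    by apply: eq_bigr => j _; rewrite ffun_consS.
  rewrite sumE [X in X * _ * _]big_ord_recl [X in _ * X * _]big_ord_recl !ffun_cons0.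
  have -> : (\sum_(q < p.+1 | (@ord0 p < q)%N) ffun_cons x g q)%N = L.
    rewrite big_mkcond big_ord_recl /= add0n.
    by apply: eq_bigr => j _; rewrite ffun_consS.
  have -> : (\sum_(q < p.+1 | (@ord0 p <= q)%N) ffun_cons x g q)%N = (L + x)%N.
    by rewrite -sumE; apply: eq_bigl => q.
  have -> : \prod_(i < p) (poch (alpha (lift ord0 i) + 1) (n (lift ord0 i)) *
    (poch (- (n (lift ord0 i))%:R) (ffun_cons x g (lift ord0 i)) /
     (ffun_cons x g (lift ord0 i))`!%:R)) = P1.
    by apply: eq_bigr => j _; rewrite ffun_consS.
  have -> : \prod_(r < p) (poch (alpha (lift ord0 r) + (n (lift ord0 r))%:R + 1)
       (\sum_(q < p.+1 | (lift ord0 r < q)%N) ffun_cons x g q)%N /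
      poch (alpha (lift ord0 r) + 1)
       (\sum_(q < p.+1 | (lift ord0 r <= q)%N) ffun_cons x g q)%N) = P2.
    apply: eq_bigr => j _; congr (poch _ _ / poch _ _).
      rewrite big_mkcond big_ord_recl /= add0n [RHS]big_mkcond.
      by apply: eq_bigr => i _; rewrite ffun_consS.
    rewrite big_mkcond big_ord_recl /= add0n [RHS]big_mkcond.
    by apply: eq_bigr => i _; rewrite ffun_consS.
  rewrite /c addrAC -/n0 -/c; ring.
rewrite -(@big_ord_widen _ _ _ n0.+1 N.+1 (fun x => P1 * P2 *
   (poch c n0 * (poch (- n0%:R) x / x`!%:R) *
   (poch (c + n0%:R) L / poch c (L + x)) * poch (s + 1) (L + x)))) ?ltnS ?nN //.
have cL j : c + L%:R + j%:R != 0 by rewrite -addrA -natrD a0.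
(* (x)_(L + i) = (x)_L (x + L)_i puts the sum over l_0 into 2F1 form. *)
have := @chu_vandermonde R n0 (s + 1 + L%:R) (c + L%:R) cL.
rewrite big_mkord => chu.
have cn0 : poch c n0 != 0 by exact: poch_neq0 (a0 ord0).
have cL0 : poch c L != 0 by exact: poch_neq0 (a0 ord0).
have cLn0 : poch (c + L%:R) n0 != 0 by exact: poch_neq0.
transitivity (P1 * P2 * poch (s + 1) L * (poch c n0 * poch (c + n0%:R) L / poch c L) *
  \sum_(i < n0.+1) poch (- n0%:R) i / i`!%:R * (poch (s + 1 + L%:R) i / poch (c + L%:R) i)).
  rewrite mulr_sumr; apply: eq_bigr => i _; rewrite !pochD.
  have ? : poch (c + L%:R) i != 0 by exact: poch_neq0.
  have ? : i`!%:R != 0 :> R by rewrite pnatr_eq0 -lt0n fact_gt0.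
  by field; apply/and3P.
rewrite chu -pochD addnC pochD.
have -> : c + L%:R - (s + 1 + L%:R) = alpha ord0 - s by rewrite /c; ring.
by field; rewrite cL0 cLn0.
Qed.
End TypeII.

Section Mellin.
Variable R : realType.
Implicit Types (f g : {poly R}) (s c : R).

(** The integral of x^s f(x) e^(-x) over [0, +oo) divided by Gamma(s + 1),
    written out on the coefficients of f. *)
Definition mellin s f : R := \sum_(l < size f) f`_l * poch (s + 1) l.

Lemma mellin_wide N s f : (size f <= N)%N ->
  mellin s f = \sum_(l < N) f`_l * poch (s + 1) l.
Proof.
move=> fN; rewrite /mellin (big_ord_widen _ (fun l => f`_l * poch (s + 1) l) fN) big_mkcond.
by apply: eq_bigr => l _; case: ltnP => // h; rewrite nth_default // mul0r.
Qed.

Lemma mellinD s f g : mellin s (f + g) = mellin s f + mellin s g.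
Proof.
rewrite (mellin_wide _ (size_polyD f g)).
rewrite (mellin_wide _ (leq_maxl (size f) (size g))) (mellin_wide _ (leq_maxr (size f) (size g))).
by rewrite -big_split; apply: eq_bigr => l _; rewrite coefD mulrDl.
Qed.

Lemma mellinZ s c f : mellin s (c *: f) = c * mellin s f.
Proof.
rewrite (mellin_wide _ (size_scale_leq c f)) mulr_sumr.
by apply: eq_bigr => l _; rewrite coefZ mulrA.
Qed.

Lemma mellin0 s : mellin s 0 = 0.
Proof. by rewrite /mellin size_poly0 big_ord0. Qed.

Lemma mellin_sum s I (r : seq I) (P : pred I) (F : I -> {poly R}) :
  mellin s (\sum_(i <- r | P i) F i) = \sum_(i <- r | P i) mellin s (F i).
Proof. exact: (big_morph _ (mellinD s) (mellin0 s)). Qed.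

Lemma mellinXn s l : mellin s 'X^l = poch (s + 1) l.
Proof.
rewrite /mellin size_polyXn big_ord_recr /= coefXn eqxx mul1r big1 ?add0r // => i _.
by rewrite coefXn ltn_eqF // mul0r.
Qed.

Lemma mellinMX s f : mellin s ('X * f) = (s + 1) * mellin (s + 1) f.
Proof.
have sz : (size ('X * f)%R <= (size f).+1)%N.
  by apply: leq_trans (size_polyMleq _ _) _; rewrite size_polyX.
rewrite (mellin_wide _ sz) big_ord_recl coefXM mul0r add0r /mellin mulr_sumr.
by apply: eq_bigr => l _; rewrite coefXM /= pochSl; ring.
Qed.

(** At s = - k - 1 the factor (s + 1)_l = (- k)_l vanishes for l > k but not
    for l = k, so these points determine the coefficients one by one. *)
Lemma mellin_inj f g : (forall s, mellin s f = mellin s g) -> f = g.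
Proof.
move=> fg; apply/eqP; rewrite -subr_eq0; apply/eqP; set h := f - g.
have h0 s : mellin s h = 0 by rewrite /h -scaleN1r mellinD mellinZ fg mulN1r subrr.
apply/polyP => k; rewrite coef0; elim/ltn_ind: k => k IH.
(* Padding the sum to k + 1 + size h terms lets it be split after index k. *)
have := h0 (- k%:R - 1); rewrite (mellin_wide _ (leq_addr k.+1 (size h))) subrK addnC.
rewrite big_split_ord /= [X in _ + X]big1 ?addr0 => [|i _]; last first.
  by rewrite poch_opp ffact_small ?mulr0 // addSn ltnS leq_addr.
rewrite big_ord_recr /= big1 ?add0r => [|i _]; last by rewrite IH ?mul0r.
move/eqP; rewrite mulf_eq0 poch_opp ffactnn => /orP[/eqP //|].
by rewrite mulf_eq0 signr_eq0 pnatr_eq0 -[_ == _]negbK -lt0n fact_gt0.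
Qed.

Lemma mellin_laguerreII p (alpha : 'I_p -> R) (n : 'I_p -> nat) s :
    (forall q j, alpha q + 1 + j%:R != 0) ->
  mellin s (laguerreII alpha n) =
    \prod_(q < p) \prod_(0 <= j < n q) (s - (alpha q + j%:R)).
Proof.
move=> a0; have nN q : (n q <= msize n)%N by rewrite /msize (bigD1 q) //= leq_addr.
transitivity ((-1) ^+ msize n * \prod_(q < p) poch (alpha q - s) (n q)); last first.
  rewrite /msize -prodrXr -big_split; apply: eq_bigr => q _ /=.
  by rewrite -opprB -poch_desc; apply: eq_bigr => j _; rewrite opprD addrA.
rewrite -(laguerreII_sum s nN a0) mellin_sum mulr_sumr; apply: eq_bigr => l _.
by rewrite mellinZ mellinXn -!mulrA.
Qed.
End Mellin.


(** * Coefficients of type I polynomials *)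

Section TypeI.
Variable R : realType.

(** This and [inv_prod_own] split the product of the differences between the
    node alpha_i + l and the others according to the parameter that they come
    from; here b = alpha_i - alpha_q with q != i.  Both
    (b - N + 1)_l (b - N + 1 + l)_N and (b - N + 1)_N (b + 1)_l are equal to
    (b - N + 1)_(N + l), which shows how the product varies with l. *)
Lemma inv_prod_other (b : R) N l : (forall z : int, b + z%:~R != 0) ->
  (\prod_(0 <= j < N) (b + l%:R - j%:R))^-1 =
  (-1) ^+ N / poch (- b) N * (poch (b - N%:R + 1) l / poch (b + 1) l).
Proof.
move=> b0.
have p1 m : poch (b + 1) m != 0.
  apply: poch_neq0 => j; have := b0 (j.+1%:Z).
  by rewrite -pmulrn -natr1 [j%:R + 1]addrC addrA.
have p2 : poch (- b) N != 0.
  apply: poch_neq0 => j; have := b0 (- j%:Z).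
  by rewrite -oppr_eq0 intrN -pmulrn opprD opprK.
have revE c M : \prod_(0 <= j < M) (c - j%:R) = poch (c - M%:R + 1) M :> R.
  rewrite big_nat_rev; apply: eq_big_nat => j /andP[_ jM]; rewrite add0n natrB //.
  by rewrite -natr1; ring.
have E : poch (b - N%:R + 1) l * poch (b + l%:R - N%:R + 1) N =
         (-1) ^+ N * poch (- b) N * poch (b + 1) l.
  rewrite -poch_desc revE.
  have -> : b + l%:R - N%:R + 1 = b - N%:R + 1 + l%:R by ring.
  by rewrite -pochD addnC pochD; congr (_ * poch _ _); ring.
rewrite revE.
have s0 : (-1) ^+ N != 0 :> R by rewrite signr_eq0.
have ne : poch (b - N%:R + 1) l * poch (b + l%:R - N%:R + 1) N != 0.
  by rewrite E !mulf_neq0.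
have n2 : poch (b + l%:R - N%:R + 1) N != 0 by apply: contraNneq ne => ->; rewrite mulr0.
apply: (mulIf n2); rewrite mulVf //.
transitivity ((-1) ^+ N * (poch (b - N%:R + 1) l * poch (b + l%:R - N%:R + 1) N)
  / (poch (- b) N * poch (b + 1) l)); last by field; rewrite p2 p1.
by rewrite E !mulrA -expr2 sqrr_sign mul1r divff // mulf_neq0.
Qed.

Lemma inv_prod_own N l : (l < N)%N ->
  (\prod_(0 <= j < N | j != l) (l%:R - j%:R))^-1 =
  (-1) ^+ (N - 1) * poch (- N%:R + 1) l / ((N - 1)`!%:R * l`!%:R) :> R.
Proof.
case: N => // N; rewrite ltnS => lN.
have -> : - N.+1%:R + 1 = - N%:R :> R by rewrite -natr1; ring.
rewrite subn1 /= poch_opp -(ffact_fact lN) natrM.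
rewrite (big_cat_nat (n := l)) //=; last exact: leqW.
rewrite (big_ltn_cond (m := l)) // eqxx /=.
have -> : \prod_(0 <= j < l | j != l) (l%:R - j%:R) = l`!%:R :> R.
  by rewrite prod_nat_neq ?ltnn ?andbF // poch_desc poch_opp ffactnn mulrA -expr2 sqrr_sign mul1r.
have -> : \prod_(l.+1 <= j < N.+1 | j != l) (l%:R - j%:R) = (-1) ^+ (N - l) * (N - l)`!%:R :> R.
  rewrite prod_nat_neq ?ltnn // -[l.+1]add0n big_addn subSS -poch_factorial /poch.
  rewrite -[X in (-1) ^+ X]subn0.
  rewrite -prodr_const_nat -big_split; apply: eq_bigr => j _ /=.
  by rewrite natrD -natr1; ring.
have f0 m : m`!%:R != 0 :> R by rewrite pnatr_eq0 -lt0n fact_gt0.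
have ff0 : (N ^_ l)%:R != 0 :> R by rewrite pnatr_eq0 -lt0n ffact_gt0.
have -> : (-1) ^+ N = (-1) ^+ (N - l) * (-1) ^+ l :> R by rewrite -exprD subnK.
rewrite -[_ * (-1) ^+ l * _]mulrA signrMK !invfM invr_sign.
by field; rewrite !f0 ff0.
Qed.

(** The last factor is the residue at alpha_i + l of the reciprocal of the
    polynomial with zeros alpha_q + j for j < n_q, the zeros of the Mellin
    transform of the type II polynomial with the same multi-index. *)
Lemma coef_laguerreI p (alpha : 'I_p -> R) (n : 'I_p -> nat) i l :
    (forall q, q != i -> forall z : int, alpha i - alpha q + z%:~R != 0) ->
  (laguerreI alpha n i)`_l =
  if (l < n i)%N then
    (Gamma (alpha i + 1) * poch (alpha i + 1) l)^-1 *
    (\prod_(q < p) \prod_(0 <= j < n q | ~~ ((q == i) && (j == l)))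
        (alpha i + l%:R - (alpha q + j%:R)))^-1
  else 0.
Proof.
move=> b0; rewrite /laguerreI; case: eqP => [->|/eqP ni0]; first by rewrite coef0.
pose E l := poch (- (n i)%:R + 1) l / (l`!%:R * poch (alpha i + 1) l) *
  \prod_(q < p | q != i) (poch (alpha i - alpha q - (n q)%:R + 1) l / poch (alpha i - alpha q + 1) l).
rewrite coefZ big_mkord -(poly_def (n i) E) coef_poly /E {E}.
case: ifP => [ln|_]; last by rewrite mulr0.
rewrite [X in _ * X^-1](bigD1 i) //= !invfM.
have -> : \prod_(0 <= j < n i | ~~ ((i == i) && (j == l))) (alpha i + l%:R - (alpha i + j%:R))
  = \prod_(0 <= j < n i | j != l) (l%:R - j%:R).
  by apply: eq_big => [j|j _]; [rewrite eqxx | rewrite opprD addrACA subrr add0r].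
rewrite inv_prod_own //.
have -> : (\prod_(q < p | q != i) \prod_(0 <= j < n q | ~~ ((q == i) && (j == l)))
    (alpha i + l%:R - (alpha q + j%:R)))^-1 =
  \prod_(q < p | q != i) ((-1) ^+ n q * (poch (alpha q - alpha i) (n q))^-1 *
    (poch (alpha i - alpha q - (n q)%:R + 1) l / poch (alpha i - alpha q + 1) l)).
  rewrite -prodfV; apply: eq_bigr => q qi.
  rewrite -[alpha q - alpha i]opprB -inv_prod_other; last exact: b0.
  by congr _^-1; apply: eq_big => [j|j _]; [rewrite (negPf qi) | ring].
rewrite !big_split /= prodfV prodrXr.
have -> : (msize n - 1 = (n i - 1) + \sum_(q < p | q != i) n q)%N.
  by rewrite /msize (bigD1 i) //= addnBAC // lt0n.
rewrite exprD !invfM !prodfV; ring.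
Qed.
End TypeI.

(** * Step-line indices and the extended parameters *)

(** Step-line indices count along residue classes: n_q is the number of t < n
    with t = q modulo p. *)
Lemma ltn_stepline p n (q : 'I_p) j : (j < stepline n q)%N = (j * p + q < n)%N.
Proof.
have p0 : (0 < p)%N by case: p q => [[]|].
rewrite /stepline; move: (n %/ p)%N (n %% p)%N (divn_eq n p) (ltn_pmod n p0) (nat_of_ord q)
  (ltn_ord q).
move=> m k -> kp r rp.
case: (ltngtP j m) => [jm|mj|->].
- have : (j.+1 * p <= m * p)%N by rewrite leq_mul2r jm orbT.
  by rewrite mulSn; case: (ltnP r k); lia.
- have : (m.+1 * p <= j * p)%N by rewrite leq_mul2r mj orbT.
  by rewrite mulSn; case: (ltnP r k); lia.
- by rewrite ltn_add2l; case: (ltnP r k) => _; rewrite ?ltnSn ?ltnn.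
Qed.

Lemma stepline_succ p n (q : 'I_p) : stepline n.+1 q = (stepline n q + (n %% p == q))%N.
Proof.
have p0 : (0 < p)%N by case: p q => [[]|].
rewrite /stepline modnS divnS //.
move: (n %/ p)%N (n %% p)%N (divn_eq n p) (ltn_pmod n p0) (nat_of_ord q) (ltn_ord q).
move=> m k nE kp r rp.
have -> : (p %| n.+1)%N = (k.+1 == p).
  rewrite nE -addnS dvdn_addr ?dvdn_mull //.
  by apply/idP/eqP => [/dvdn_leq|->//]; lia.
by case: (k.+1 == p) / eqP => kE /=; rewrite ?ltn0; case: (ltnP r k.+1);
  case: (ltnP r k); case: (k =P r); rewrite /=; lia.
Qed.

Lemma big_stepline (T : Type) (idx : T) (op : Monoid.com_law idx) p
    (hp : (0 < p)%N) n (F : nat -> T) :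
  \big[op/idx]_(0 <= u < n) F u =
  \big[op/idx]_(q < p) \big[op/idx]_(0 <= j < stepline n q) F (j * p + q)%N.
Proof.
elim: n => [|n IH].
  rewrite big_geq // big1 // => q _.
  by rewrite /stepline mod0n div0n ltn0 big_geq.
rewrite big_nat_recr //= IH.
transitivity (\big[op/idx]_(q < p) op (\big[op/idx]_(0 <= j < stepline n q) F (j * p + q)%N)
   (if q == Ordinal (ltn_pmod n hp) then F n else idx)).
  by rewrite big_split /= -big_mkcond big_pred1_eq.
apply: eq_bigr => q _; rewrite stepline_succ -val_eqE eq_sym /=.
case: eqP => [qE|_]; last by rewrite addn0 Monoid.mulm1.
rewrite addn1 big_nat_recr //=; congr (op _ (F _)).
by rewrite /stepline -qE ltnn -divn_eq.
Qed.

Section Nodes.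
Variables (R : realType) (p : nat) (hp : (0 < p)%N) (alpha : 'I_p -> R).
Hypothesis hint : forall i j : 'I_p, i != j -> alpha i - alpha j \isn't a Num.int.

Local Notation a := (alpha_ext hp alpha).

Lemma alpha_extE j (q : 'I_p) : a (j * p + q) = alpha q + j%:R.
Proof.
rewrite /alpha_ext divnMDl // divn_small // addn0; congr (alpha _ + _).
by apply: val_inj; rewrite /= modnMDl modn_small.
Qed.

Lemma alpha_ext_shift m t : a (t + m * p) = a t + m%:R.
Proof.
rewrite /alpha_ext addnC divnMDl // natrD addrCA addrC; congr (alpha _ + _ + _).
by apply: val_inj; rewrite /= modnMDl.
Qed.

(** Divided differences and residues need distinct nodes: those with different
    residues modulo p come from parameters that do not differ by an integer. *)
Lemma alpha_ext_inj : injective a.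
Proof.
move=> t u; rewrite /alpha_ext => E.
have E1 : alpha (Ordinal (ltn_pmod t hp)) - alpha (Ordinal (ltn_pmod u hp)) =
    (u %/ p)%:R - (t %/ p)%:R.
  by apply/eqP; rewrite subr_eq addrAC -subr_eq opprK E addrC.
have [qE|/hint] := eqVneq (Ordinal (ltn_pmod t hp)) (Ordinal (ltn_pmod u hp)).
  move: E; rewrite qE => /addrI/eqP; rewrite eqr_nat => /eqP dE.
  by move/(congr1 val): qE => /= mE; rewrite (divn_eq t p) (divn_eq u p) dE mE.
by rewrite E1 rpredB // ?natr_int.
Qed.

Definition nodes u v : seq R := [seq a t | t <- index_iota u v].

Lemma nodes_uniq u v : uniq (nodes u v).
Proof. by rewrite (map_inj_uniq alpha_ext_inj) iota_uniq. Qed.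

Lemma nodepoly_cat u v w : (u <= v)%N -> (v <= w)%N ->
  nodepoly (nodes u v) * nodepoly (nodes v w) = nodepoly (nodes u w).
Proof. by move=> uv vw; rewrite /nodepoly !big_map -big_cat_nat. Qed.

Lemma horner_nodes u v x : (nodepoly (nodes u v)).[x] = \prod_(u <= t < v) (x - a t).
Proof. by rewrite horner_nodepoly big_map. Qed.

Lemma horner_nodes_shift n x :
  (nodepoly (nodes p (n + p))).[x + 1] = (nodepoly (nodes 0 n)).[x].
Proof.
rewrite !horner_nodes -{1}[p]add0n big_addn addnK; apply: eq_bigr => t _.
by have := alpha_ext_shift 1 t; rewrite mul1n => ->; ring.
Qed.

Lemma nodepoly_root u v t : (u <= t < v)%N -> (nodepoly (nodes u v)).[a t] = 0.
Proof.
move=> h; apply/eqP; rewrite -[_ == _]/(root _ _) root_prod_XsubC map_f //.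
by rewrite mem_index_iota.
Qed.

Definition recpoly : {poly R} := 'X * nodepoly (nodes 0 p).

Lemma recpoly_monic : recpoly \is monic.
Proof. by rewrite monicMr ?monicX // monic_prod_XsubC. Qed.

Lemma size_recpoly : size recpoly = p.+2.
Proof.
rewrite size_monicM ?monicX ?monic_neq0 ?monic_prod_XsubC // size_polyX size_nodepoly.
by rewrite size_map size_iota subn0.
Qed.

(** The index range of b^j_(p m + k) starts at k, not at n = p m + k; moving it
    by p m adds m to each node, which turns alpha_i + m into a node and
    leaves the differences unchanged. *)
Lemma recbE j n : (j <= p)%N -> recb hp alpha j n = divdiff recpoly (nodes n (n + p - j).+1).
Proof.
move=> jp; rewrite /recb /recb_mk /divdiff /nodes big_map.
set m := (n %/ p)%N; set k := (n %% p)%N.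
have nE : n = (k + m * p)%N by rewrite addnC -divn_eq.
have -> : (n + p - j).+1 = ((p + k - j).+1 + m * p)%N by lia.
rewrite {1 2}nE [RHS]big_addn addnK; apply: eq_bigr => i _.
rewrite alpha_ext_shift; congr (_ / _).
  rewrite /recpoly hornerM hornerX horner_nodes big_mkord; congr (_ * _).
  apply: eq_bigr => q _; have := alpha_extE 0 q; rewrite mul0n add0n addr0 => ->; ring.
rewrite big_map big_addn addnK; apply: eq_big => [q|q _].
  by rewrite -alpha_ext_shift (inj_eq alpha_ext_inj) eqn_add2r.
by rewrite alpha_ext_shift; ring.
Qed.

Lemma take_nodes u v i : (u + i <= v)%N -> take i (nodes u v) = nodes u (u + i).
Proof.
move=> h; rewrite /nodes -map_take /index_iota take_iota; congr (map _ (iota _ _)); lia.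
Qed.

Lemma drop_nodes u v i : drop i (nodes u v) = nodes (u + i) v.
Proof. by rewrite /nodes -map_drop /index_iota drop_iota subnDA. Qed.

Lemma size_nodes u v : size (nodes u v) = (v - u)%N.
Proof. by rewrite size_map size_iota. Qed.

Lemma newton_forward n :
  recpoly = nodepoly (nodes n (n + p).+1)
    + \sum_(0 <= j < p.+1) recb hp alpha j n *: nodepoly (nodes n (n + p - j)).
Proof.
rewrite {1}(newton_monic (nodes_uniq n (n + p).+1) recpoly_monic); last first.
  by rewrite size_recpoly size_nodes; lia.
congr (_ + _); rewrite size_nodes (_ : ((n + p).+1 - n = p.+1)%N); last lia.
rewrite -(big_mkord xpredT (fun i => divdiff recpoly (take i.+1 (nodes n (n + p).+1))
  *: nodepoly (take i (nodes n (n + p).+1)))) big_nat_rev.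
apply: eq_big_nat => j /andP[_ jp]; rewrite add0n subSS.
rewrite recbE // !take_nodes; [|lia|lia].
by congr (divdiff _ (nodes _ _) *: nodepoly (nodes _ _)); lia.
Qed.

(** Newton interpolation with the nodes taken in reverse order; divided
    differences do not depend on that order. *)
Lemma newton_backward n :
  recpoly = nodepoly (nodes n (n + p).+1)
    + \sum_(0 <= j < p.+1) recb hp alpha j (n + j) *: nodepoly (nodes (n + j).+1 (n + p).+1).
Proof.
have nrev s : nodepoly (rev s) = nodepoly s :> {poly R}.
  by apply: perm_big; rewrite perm_rev.
have drev f s : divdiff f (rev s) = divdiff f s :> R.
  by apply: divdiff_perm; rewrite perm_rev.
have us : uniq (rev (nodes n (n + p).+1)) by rewrite rev_uniq nodes_uniq.
rewrite {1}(newton_monic us recpoly_monic); last first.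
  by rewrite size_recpoly size_rev size_nodes; lia.
rewrite nrev; congr (_ + _); rewrite size_rev size_nodes (_ : ((n + p).+1 - n = p.+1)%N); last lia.
rewrite -(big_mkord xpredT (fun i => divdiff recpoly (take i.+1 (rev (nodes n (n + p).+1)))
  *: nodepoly (take i (rev (nodes n (n + p).+1))))) big_nat_rev.
apply: eq_big_nat => j /andP[_ jp]; rewrite add0n subSS.
rewrite recbE // !take_rev nrev drev !drop_nodes size_nodes.
by congr (divdiff _ (nodes _ _) *: nodepoly (nodes _ _)); lia.
Qed.
End Nodes.

(** * The recurrences *)

Section Recurrences.
Variables (R : realType) (p : nat) (hp : (0 < p)%N) (alpha : 'I_p -> R).
Hypothesis halpha : forall i : 'I_p, -1 < alpha i.
Hypothesis hint : forall i j : 'I_p, i != j -> alpha i - alpha j \isn't a Num.int.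

Local Notation a := (alpha_ext hp alpha).
Local Notation nodes := (nodes hp alpha).
Local Notation recpoly := (recpoly hp alpha).

Lemma alpha1_neq0 q j : alpha q + 1 + j%:R != 0.
Proof. by rewrite gt_eqF // ltr_wpDr ?ler0n // -ltrBlDr sub0r. Qed.

Lemma mellin_stepB s n : mellin s (stepB alpha n) = (nodepoly (nodes 0 n)).[s].
Proof.
rewrite /stepB mellin_laguerreII ?horner_nodes; last exact: alpha1_neq0.
rewrite (big_stepline _ hp); apply: eq_bigr => q _; apply: eq_bigr => j _.
by rewrite alpha_extE.
Qed.

(** All the nodes involved have index below p, and so are zeros of f. *)
Lemma recb_small j n : (n < j <= p)%N -> recb hp alpha j n = 0.
Proof.
move=> /andP[nj jp]; rewrite recbE // /divdiff big_seq big1 // => x /mapP[t].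
rewrite mem_index_iota => /andP[_ tn] ->.
by rewrite /recpoly hornerM (@nodepoly_root _ _ _ _ 0 p) ?mulr0 ?mul0r //; lia.
Qed.

(** Multiplying by w(0,p) makes each w(p,v) into w(0,v), which also arises from
    w(n,v) in [newton_forward] by multiplying by w(0,n). *)
Lemma nodepoly_recurrence n :
  'X * nodepoly (nodes 0 n) = nodepoly (nodes p (n + p).+1)
    + \sum_(0 <= j < p.+1 | (j <= n)%N) recb hp alpha j n *: nodepoly (nodes p (n - j + p)).
Proof.
have w0 : nodepoly (nodes 0 p) != 0 by rewrite monic_neq0 ?monic_prod_XsubC.
apply: (mulfI w0); rewrite mulrDr nodepoly_cat ?leq0n ?leqW ?leq_addl //.
rewrite mulrCA mulrA -/(recpoly) {1}(newton_forward hp hint n) mulrDl mulrC.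
rewrite nodepoly_cat ?leqW ?leq_addr //.
congr (_ + _); rewrite mulr_suml mulr_sumr [RHS]big_mkcond; apply: eq_big_nat => j /andP[_ jp].
rewrite -scalerAl mulrC; case: leqP => jn; last by rewrite recb_small ?scale0r //; lia.
have nj : (n <= n + p - j)%N by lia.
by rewrite -scalerAr !nodepoly_cat ?leq_addl // addnBAC.
Qed.

Lemma stepB_recurrence n :
  'X * stepB alpha n = stepB alpha n.+1
    + \sum_(0 <= j < p.+1 | (j <= n)%N) recb hp alpha j n *: stepB alpha (n - j).
Proof.
apply: mellin_inj => s; rewrite mellinMX mellinD !mellin_stepB [X in _ = _ + X]mellin_sum.
have := congr1 (fun f => f.[s + 1]) (nodepoly_recurrence n).
rewrite /= hornerM hornerX => ->; rewrite hornerD -addSn horner_nodes_shift; congr (_ + _).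
rewrite horner_sum; apply: eq_bigr => j _.
by rewrite hornerZ horner_nodes_shift mellinZ mellin_stepB.
Qed.

(** The residue at a_t of 1 / w(0,n). *)
Definition residue n t : R :=
  if (t < n)%N then (\prod_(0 <= u < n | u != t) (a t - a u))^-1 else 0.

Lemma prod_nodes_neq0 n t : \prod_(0 <= u < n | u != t) (a t - a u) != 0.
Proof.
rewrite prodf_seq_neq0; apply/allP => u _; apply/implyP => ut.
by rewrite subr_eq0 (inj_eq (alpha_ext_inj hint)) eq_sym.
Qed.

(** Over the common denominator w(0,N), the numerator w(n,N) also produces the
    value 0 when a_t is not a pole, that is, when n <= t. *)
Lemma residue_wide n N t : (n <= N)%N -> (t < N)%N ->
  residue n t = (nodepoly (nodes n N)).[a t] / \prod_(0 <= u < N | u != t) (a t - a u).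
Proof.
move=> nN tN; rewrite /residue; case: ltnP => tn; last by rewrite nodepoly_root ?mul0r ?tn.
have E : \prod_(0 <= u < N | u != t) (a t - a u) =
    \prod_(0 <= u < n | u != t) (a t - a u) * (nodepoly (nodes n N)).[a t].
  by rewrite (big_cat_nat (n := n)) //= horner_nodes (@prod_nat_neq _ n N) // tN andbT -ltnNge.
have := prod_nodes_neq0 N t; rewrite E mulf_eq0 negb_or => /andP[A B].
by rewrite invfM mulrCA divff ?mulr1.
Qed.

(** The residue of 1 / w(0,n) at a_(t-p) = a_t - 1 is that of 1 / w(p,n+p) at
    a_t. *)
Lemma residue_shift n t : (t < n + p)%N ->
  (if (p <= t)%N then residue n (t - p) else 0) =
  (nodepoly (nodes 0 p)).[a t] / \prod_(0 <= u < n + p | u != t) (a t - a u).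
Proof.
move=> tn; case: leqP => pt; last by rewrite nodepoly_root ?mul0r.
have E : \prod_(0 <= u < n + p | u != t) (a t - a u) =
  (nodepoly (nodes 0 p)).[a t] * \prod_(0 <= u < n | (u != t - p)%N) (a (t - p)%N - a u).
  rewrite (big_cat_nat (n := p)) ?leq_addl //= horner_nodes; congr (_ * _).
    by rewrite prod_nat_neq // -leqNgt.
  rewrite -{1}[p]add0n big_addn addnK; apply: eq_big => [u|u _]; first by apply/idP/idP; lia.
  have sh v : a (v + p)%N = a v + 1 by have := alpha_ext_shift hp alpha 1 v; rewrite mul1n.
  by rewrite sh -{1}(subnK pt) sh; ring.
have := prod_nodes_neq0 (n + p) t; rewrite E mulf_eq0 negb_or => /andP[A B].
rewrite /residue ifT; last lia.
by rewrite invfM mulrA divff ?mul1r.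
Qed.

(** For t <= n + p this is [newton_backward] at a_t, divided by the product of
    the differences between a_t and the other nodes of w(0,n+p+1); for larger
    t there is no pole at a_t on either side. *)
Lemma residue_recurrence n t :
  a t * (if (p <= t)%N then residue n.+1 (t - p) else 0) =
  residue n t + \sum_(0 <= j < p.+1) recb hp alpha j (n + j) * residue (n + j).+1 t.
Proof.
have [tn|nt] := ltnP t (n + p).+1; last first.
  have r0 v w : (v <= w)%N -> residue v w = 0 by rewrite /residue ltnNge => ->.
  have -> : residue n.+1 (t - p) = 0 by apply: r0; lia.
  have -> : residue n t = 0 by apply: r0; lia.
  rewrite if_same mulr0 add0r big_nat big1 // => j /andP[_ jp].
  by rewrite r0 ?mulr0 //; lia.
rewrite -addSn in tn *; rewrite residue_shift // mulrA.
have -> : a t * (nodepoly (nodes 0 p)).[a t] = recpoly.[a t] by rewrite hornerM hornerX.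
have np : (n <= (n + p).+1)%N by lia.
rewrite {1}(newton_backward hp hint n) addSn hornerD mulrDl -residue_wide //.
congr (_ + _); rewrite horner_sum mulr_suml; apply: eq_big_nat => j /andP[_ jp].
by rewrite hornerZ -mulrA -residue_wide //; lia.
Qed.

(** Position l * p + i of the node list holds alpha_i + l. *)
Lemma coef_stepA i n l :
  (stepA alpha i n)`_l =
  (Gamma (alpha i + 1) * poch (alpha i + 1) l)^-1 * residue n (l * p + i).
Proof.
rewrite /stepA coef_laguerreI; last first.
  move=> q qi z; rewrite eq_sym in qi; apply: contra (hint qi); rewrite addr_eq0 => /eqP ->.
  by rewrite rpredN intr_int.
rewrite ltn_stepline /residue; case: ifP => _; last by rewrite mulr0.
congr (_ * _^-1); rewrite [RHS]big_mkcond [RHS](big_stepline _ hp).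
apply: eq_bigr => q _; rewrite big_mkcond; apply: eq_bigr => j _; rewrite !alpha_extE.
congr (if ~~ _ then _ else _); apply/andP/eqP => [[/eqP-> /eqP->]//|E].
have qi : q = i by apply: val_inj; move: (congr1 (modn^~ p) E); rewrite /= !modnMDl !modn_small.
by move/eqP: E; rewrite qi eqn_add2r eqn_pmul2r // => ->.
Qed.

Lemma stepA_recurrence n i :
  'X * stepA alpha i n.+1 = stepA alpha i n
    + \sum_(0 <= j < p.+1) recb hp alpha j (n + j) *: stepA alpha i (n + j).+1.
Proof.
apply/polyP => l; rewrite coefXM coefD coef_sum.
under [X in _ = _ + X]eq_bigr => j _ do rewrite coefZ coef_stepA mulrCA.
rewrite -mulr_sumr !coef_stepA -mulrDr -residue_recurrence.
case: l => [|l] /=; first by rewrite mul0n add0n leqNgt ltn_ord !mulr0.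
rewrite ifT; last by rewrite mulSn -addnA leq_addr.
rewrite alpha_extE mulSn -addnA addKn pochSr !invfM -natr1.
have := alpha1_neq0 i l; rewrite -addrA [1 + _]addrC => h.
by rewrite -!mulrA; congr (_ * (_ * _)); rewrite mulrA mulVf ?mul1r.
Qed.

End Recurrences.

Theorem corollary3p1 (R : realType) (p : nat) (hp : (0 < p)%N) (alpha : 'I_p -> R)
    (halpha : forall i : 'I_p, -1 < alpha i)
    (hint : forall i j : 'I_p, i != j -> alpha i - alpha j \isn't a Num.int) :
  (forall n : nat,
     'X * stepB alpha n =
       stepB alpha n.+1 + recb hp alpha 0 n *: stepB alpha n
       (* the terms with n - j < 0 are left out, as B_r = 0 for r < 0 *)
       + \sum_(1 <= j < p.+1 | (j <= n)%N) recb hp alpha j n *: stepB alpha (n - j))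
  /\
  (forall (n : nat) (i : 'I_p), (1 <= n)%N ->
     'X * stepA alpha i n =
       stepA alpha i (n - 1) + recb hp alpha 0 (n - 1) *: stepA alpha i n
       + \sum_(1 <= j < p.+1) recb hp alpha j (n + j - 1) *: stepA alpha i (n + j)).
Proof.
split=> [n|[//|n] i _].
  by rewrite (stepB_recurrence hp halpha hint) big_ltn_cond // subn0 addrA.
rewrite (stepA_recurrence hp halpha hint) big_ltn // addn0 subn1 addrA; congr (_ + _).
by apply: eq_bigr => j _; rewrite addSn subn1.
Qed.
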